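(* Assume $n=2$, $k\ge 1$ and $d=k+2$. Then $O_{k,2,k+2}^s$ is not defective for every $s\geq 3$, and $O_{k,2,k+2}^s$ is defective for $s=2$.
   Context: Let $K$ be an algebraically closed field of characteristic $0$, $R=K[x_0,\dots,x_n]$, $R_d$ the space of forms of degree $d$, $N=\binom{n+d}{n}-1$ and $\mathbb{P}^N=\mathbb{P}(R_d)$. The Veronese variety is $X_{n,d}=\{[L^d] : L\in R_1\setminus\{0\}\}\subset\mathbb{P}^N$. For $d\ge k\ge 0$, its $k$-th osculating variety (the closure of the union of the linear spans of the $k$-th infinitesimal neighbourhoods of points of $X_{n,d}$) is $O_{k,n,d}=\{[L^{d-k}F] : L\in R_1\setminus\{0\},\ F\in R_k\setminus\{0\}\}$. $O_{k,n,d}^s$ denotes the closure of the union of all linear spaces spanned by $s$ points of $O_{k,n,d}$; equivalently the closure of the set of classes of forms $L_1^{d-k}F_1+\dots+L_s^{d-k}F_s$ with $L_i\in R_1$, $F_i\in R_k$. Its expected dimension is $\operatorname{expdim} O_{k,n,d}^s=\min\{N,\ s\binom{k+n}{n}+sn-1\}$; it is called defective if $\dim O_{k,n,d}^s<\operatorname{expdim} O_{k,n,d}^s$. *)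

(* Defs.v *)
From HB Require Import structures.
From mathcomp Require Import all_boot all_order all_algebra.
From mathcomp Require Import classical_sets.
From mathcomp Require Import mpoly.

Set Implicit Arguments.
Unset Strict Implicit.
Unset Printing Implicit Defensive.

Import GRing.Theory.

Local Open Scope ring_scope.
Local Open Scope classical_set_scope.

(* Classical projective space P(V): the lines through the origin of V. *)
Definition proj (K : fieldType) (V : vectType K) : Type :=
  {x : {vspace V} | \dim x == 1%N}.

Section Zariski.
Variables (K : fieldType) (V : vectType K).
Implicit Types (Z A B : set (proj V)).

(* The homogeneous coordinates are the coordinates in the basis
   vbasis {:V}; the closed sets do not depend on the choice of a basis. *)
Definition hcoord (v : V) : 'I_(\dim {:V}) -> K :=
  fun i => coord (vbasis {:V}) i v.

Definition vanishes_at (p : {mpoly K[\dim {:V}]}) (x : proj V) : Prop :=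
  forall v : V, v \in val x -> v != 0 -> p.@[hcoord v] = 0.

Definition zariski_closed Z : Prop :=
  exists S : set {mpoly K[\dim {:V}]},
    (forall p, S p -> exists e : nat, p \is e.-homog) /\
    Z = [set x | forall p, S p -> vanishes_at p x].

Definition zariski_closure A : set (proj V) := smallest zariski_closed A.

Definition irreducible_closed Z : Prop :=
  [/\ zariski_closed Z, Z !=set0 &
      forall A B, zariski_closed A -> zariski_closed B ->
        Z `<=` A `|` B -> Z `<=` A \/ Z `<=` B].

(* There is a chain C 0 < C 1 < ... < C m of irreducible closed subsets of
   the closed set Z; the values of C beyond m are irrelevant. *)
Definition irreducible_chain Z (m : nat) : Prop :=
  exists C : nat -> set (proj V),
    (forall i, (i <= m)%N -> irreducible_closed (C i) /\ C i `<=` Z) /\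
    (forall i, (i < m)%N -> C i `<` C i.+1).

(* Krull dimension. A nonempty Z without a dimension in this sense would
   have arbitrarily long chains, i.e. infinite dimension. *)
Definition has_dim Z (m : nat) : Prop :=
  irreducible_chain Z m /\
  (forall m', irreducible_chain Z m' -> (m' <= m)%N).

(* Closure of the union of the linear spans of s points of A. *)
Definition secant_variety (s : nat) A : set (proj V) :=
  zariski_closure
    [set x | exists u : 'I_s -> proj V,
       (forall i, A (u i)) /\ (val x <= \sum_(i < s) val (u i))%VS].

End Zariski.

Section Osculating.
Variable K : closedFieldType.

Definition form (n d : nat) := dhomog n.+1 K d.

Definition osculating_variety (k n d : nat) : set (proj (form n d)) :=
  [set x | exists (L : form n 1) (F : form n k) (G : form n d),
     [/\ L != 0, F != 0,
         (G : {mpoly K[n.+1]}) =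
           (L : {mpoly K[n.+1]}) ^+ (d - k) * (F : {mpoly K[n.+1]}) &
         val x = <[G]>%VS]].
Arguments osculating_variety : clear implicits.

Definition secant_osculating (s k n d : nat) : set (proj (form n d)) :=
  secant_variety s (osculating_variety k n d).
Arguments secant_osculating : clear implicits.

(* The truncation of the second subtraction matters only when s = 0. *)
Definition expdim (s k n d : nat) : nat :=
  minn ('C(n + d, n) - 1) (s * 'C(k + n, n) + s * n - 1).

Definition defective (s k n d : nat) : Prop :=
  exists2 m, has_dim (secant_osculating s k n d) m & (m < expdim s k n d)%N.

End Osculating.

(* Main.v *)
(** If [L1], ..., [Ls] vanish at a common point [P], then [sum_i Li^2 Fi] is
    singular at [P]. For [s = 2] such a point always exists, and conversely every
    form singular at [P = (p0 : p1 : p2)] with [p_i = 1] is a combination of the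
    products [X_i^(m i) * prod_(j <> i) (X_j - p_j X_i)^(m j)] with [m i <= k].
    The [N - 2] coefficients and the two coordinates of [P] describe the cone
    over the secant variety by [N] parameters, where [N + 1] is the number of
    monomials of degree [k + 2], so any [N + 1] polynomials become algebraically
    dependent on it. Along a chain of [m + 1] irreducible closed sets one obtains
    [m + 1] polynomials that are algebraically independent on the cone over the
    largest one, hence [m < N].

    For [s >= 3] the secant variety is the whole space. A monomial of degree
    [k + 2] outside the ideal [(x^2, y^2, z^2)] can only be [xyz], with [k = 1].
    When a cubic contains [a x^2 y] with [a <> 0], replacing [x] by [x + b z] with
    [b] half the ratio of the coefficients of [xyz] and [x^2 y] absorbs the
    monomial [xyz]; such cubics are dense. *)

From mathcomp Require Import all_boot all_order all_algebra.
From mathcomp Require Import boolp classical_sets.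
From mathcomp Require Import mpoly.
From mathcomp Require Import zify ring.
Require Import Defs.
Set Implicit Arguments.
Unset Strict Implicit.
Unset Printing Implicit Defensive.
Import GRing.Theory.

(** * Multivariate polynomials over an infinite field *)

Section InfiniteField.
Local Open Scope ring_scope.
Variable K : fieldType.
Hypothesis charK : [pchar K] =i pred0.

Lemma natr_inj_pchar0 : injective (fun n => n%:R : K).
Proof.
move=> m n; wlog le_mn : m n / (m <= n)%N.
  by move=> H e; case: (leqP m n) => [|/ltnW] l; [apply: H | apply/esym/H].
move=> /esym/eqP; rewrite -subr_eq0 -natrB // => /eqP e.
apply/eqP; rewrite eqn_leq le_mn /= -subn_eq0.
by move/pcharf0P: charK => <-; apply/eqP.
Qed.

(** In characteristic 0 the integers [1, ..., size q] are distinct and nonzero, too many to be roots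
    of a nonzero [q]. Testing only nonzero [t] suits rescalings of a vector. *)
Lemma poly_eq0_nonzero_roots (q : {poly K}) :
  (forall t, t != 0 -> q.[t] = 0) -> q = 0.
Proof.
move=> q0; apply/eqP; apply: contraT => qN0.
pose s : seq K := [seq i.+1%:R | i <- iota 0 (size q)].
have := @max_poly_roots _ q s qN0; rewrite size_map size_iota ltnn.
apply; last by rewrite map_inj_uniq ?iota_uniq // => m n /natr_inj_pchar0 [].
apply/allP => _ /mapP[i _ ->]; apply/rootP/q0.
by move/pcharf0P: charK => ->.
Qed.

Lemma poly_neq0_point (q : {poly K}) : q != 0 -> exists t, q.[t] != 0.
Proof.
move=> qN0; apply: contrapT => H; case/negP: qN0; apply/eqP.
apply: poly_eq0_nonzero_roots => t _; apply/eqP/negPn/negP => qt.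
by apply: H; exists t.
Qed.

End InfiniteField.

Section Multivariate.
Local Open Scope ring_scope.
Variable K : fieldType.

Lemma meval_muni n (P : {mpoly K[n.+1]}) (v : 'I_n.+1 -> K) :
  P.@[v] = (map_poly (meval (fun i => v (widen_ord (leqnSn n) i))) (muni P)).[v ord_max].
Proof.
rewrite mevalE muniE rmorph_sum horner_sum; apply: eq_bigr => m _ /=.
rewrite map_polyZ /= hornerZ map_polyXn hornerXn mevalZ mevalX -mulrA.
congr (_ * _); rewrite big_ord_recr /=; congr (_ * _).
by apply: eq_bigr => i _; rewrite mnmE.
Qed.

Lemma coef_muni n (P : {mpoly K[n.+1]}) (m : 'X_{1..n.+1}) :
  ((muni P)`_(m ord_max))@_[multinom m (widen_ord (leqnSn n) i) | i < n] = P@_m.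
Proof.
rewrite muniE coef_sum [in RHS](mpolyE P) !raddf_sum /=; apply: eq_bigr => m' _.
rewrite coefZ coefXn !mcoeffZ mcoeffX.
have [->|ne] := eqVneq m' m; first by rewrite !eqxx mulr1 mcoeffZ mcoeffX eqxx mulr1.
rewrite mulr0; have [e|_] := eqVneq (m ord_max) (m' ord_max); last by rewrite mulr0 mcoeff0.
rewrite mulr1 mcoeffZ mcoeffX; case: eqP => [/mnmP e'|]; last by rewrite mulr0.
case/eqP: ne; apply/mnmP => i.
case: (unliftP ord_max i) => [j ->|-> //].
have := e' j; rewrite !mnmE.
by congr (m' _ = m _); apply/val_inj => /=; rewrite /bump leqNgt ltn_ord.
Qed.

Lemma muni_eq0 n (P : {mpoly K[n.+1]}) : muni P = 0 -> P = 0.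
Proof. by move=> e; apply/mpolyP => m; rewrite -coef_muni e coef0 !mcoeff0. Qed.

Hypothesis charK : [pchar K] =i pred0.

(** Induction on the number of variables: [muni] splits off the last one, and fixing the others
    leaves a univariate polynomial with only zero values. *)
Lemma mpoly_eq0_fun n (P : {mpoly K[n]}) : (forall v, P.@[v] = 0) -> P = 0.
Proof.
elim: n P => [|n IHn] P P0.
  apply/mpolyP => m; have := P0 (fun=> 0); rewrite mevalE mcoeff0 => e.
  have m0 (m' : 'X_{1..0}) : m' = m by apply/mnmP; case.
  rewrite [in LHS](mpolyE P) raddf_sum /= -[RHS]e; apply: eq_bigr => m' _.
  by rewrite mcoeffZ mcoeffX (m0 m') eqxx big_ord0.
apply: muni_eq0; apply/polyP => j; rewrite coef0; apply: IHn => w.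
pose q := map_poly (meval w) (muni P).
suff q0 : q = 0 by have := congr1 (fun q : {poly K} => q`_j) q0; rewrite coef_map coef0.
apply: (poly_eq0_nonzero_roots charK) => t _.
pose v i := if unlift ord_max i is Some i' then w i' else t.
rewrite -(P0 v) meval_muni /v unlift_none /q; congr (_.[t]).
apply/polyP => l; rewrite !coef_map /=; apply: meval_eq => i.
suff -> : widen_ord (leqnSn n) i = lift ord_max i by rewrite liftK.
by apply/val_inj; rewrite /= /bump leqNgt ltn_ord.
Qed.

Lemma meval_homog_scale n d (p : {mpoly K[n]}) (t : K) (v : 'I_n -> K) :
  p \is d.-homog -> p.@[fun i => t * v i] = t ^+ d * p.@[v].
Proof.
move=> /dhomogP hp; rewrite !mevalE big_distrr /=; apply: eq_big_seq => m mp.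
have <- : mdeg m = d := hp m mp.
rewrite mulrCA; congr (_ * _); rewrite mdegE -prodrXr -big_split /=.
by apply: eq_bigr => i _; rewrite exprMn.
Qed.

Lemma line_poly n (p : {mpoly K[n]}) (a b : 'I_n -> K) :
  exists q : {poly K}, forall t, q.[t] = p.@[fun i => a i + t * b i].
Proof.
exists (mmap (@polyC K) (fun i => (a i)%:P + b i *: 'X) p) => t.
rewrite mevalE /mmap horner_sum; apply: eq_bigr => m _.
rewrite hornerM hornerC; congr (_ * _); rewrite /mmap1 horner_prod; apply: eq_bigr => i _.
by rewrite horner_exp hornerD hornerC hornerZ hornerX mulrC.
Qed.

(** Along the line through [v] the sum is [t ^+ e] times a polynomial in [t] with coefficients [(f
    d).@[v]], so these vanish one by one. *)
Lemma sum_homog_eq0 n N (f : nat -> {mpoly K[n]}) (e : nat) (v : 'I_n -> K) :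
  (forall d, f d \is (d + e).-homog) ->
  (forall t, t != 0 -> (\sum_(d < N) f d).@[fun i => t * v i] = 0) ->
  forall d, (d < N)%N -> (f d).@[v] = 0.
Proof.
move=> fh f0 d ltd; pose q := \poly_(i < N) (f i).@[v].
suff q0 : q = 0 by have := coef_poly N (fun i => (f i).@[v]) d; rewrite -/q q0 coef0 ltd.
apply: (poly_eq0_nonzero_roots charK) => t tN0.
apply: (mulfI (expf_neq0 e tN0)); rewrite mulr0 -[RHS](f0 t tN0).
rewrite rmorph_sum horner_poly big_distrr /=.
by apply: eq_bigr => i _; rewrite (meval_homog_scale _ _ (fh i)) exprD; ring.
Qed.

Lemma msize_predM_le n (p q : {mpoly K[n]}) :
  ((msize (p * q)).-1 <= (msize p).-1 + (msize q).-1)%N.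
Proof.
have [->|p0] := eqVneq p 0; first by rewrite mul0r msize0.
have [->|q0] := eqVneq q 0; first by rewrite mulr0 msize0.
rewrite msizeM //; move: p0 q0; rewrite -!msize_poly_eq0.
by case: (msize p) => // a; case: (msize q) => // b _ _; rewrite addSn addnS.
Qed.

Lemma msize_pred_prodX_le n r (h : r.-tuple {mpoly K[n]}) (m : 'X_{1..r}) D :
  (forall i, (msize (tnth h i) <= D)%N) ->
  ((msize ('X_[m] \mPo h)).-1 <= mdeg m * D)%N.
Proof.
move=> hD; rewrite comp_mpolyX mdegE big_distrl /=.
elim/big_ind2: _ => [|a p b q pa qb|i _]; first by rewrite msize1.
  by apply: leq_trans (msize_predM_le p q) _; apply: leq_add.
elim: (m i) => [|j IH]; first by rewrite expr0 msize1.
rewrite exprS mulSn; apply: leq_trans (msize_predM_le _ _) _; apply: leq_add => //.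
by apply: leq_trans (leq_pred _) (hD i).
Qed.

Lemma card_bmultinom_le M B : (#|{: 'X_{1..M < B.+1}}| <= B.+1 ^ M)%N.
Proof.
pose f (m : 'X_{1..M < B.+1}) := [ffun i : 'I_M => inord (m i) : 'I_B.+1].
have -> : (B.+1 ^ M = #|{: {ffun 'I_M -> 'I_B.+1}}|)%N by rewrite card_ffun !card_ord.
apply: (@leq_card _ _ f) => m m' /ffunP e; apply/val_inj/mnmP => i.
have lt (m1 : 'X_{1..M < B.+1}) : (m1 i < B.+1)%N.
  by apply: leq_ltn_trans (bmdeg m1); rewrite mdegE (bigD1 i) //= leq_addr.
by have := congr1 val (e i); rewrite !ffunE /= !inordK.
Qed.

(** By counting: there are [e ^ r] monomials in [h] with all exponents below [e], and they lie in a
    space of dimension at most [(e * c) ^ M], which is smaller for large [e] because [M < r]. *)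
Lemma alg_dep M r (h : r.-tuple {mpoly K[M]}) :
  (M < r)%N -> exists2 P : {mpoly K[r]}, P != 0 & P \mPo h = 0.
Proof.
move=> ltMr.
pose D := (\max_(i < r) msize (tnth h i))%N.
(* Substituting [h] gives degree at most [e * (r * D)], hence [msize] at most [e * c]; and
   [e > c ^ M] yields [(e * c) ^ M < e ^ M.+1 <= e ^ r]. *)
pose c := (r * D).+1.
pose e := (c ^ M).+1.
pose B := (e * c).-1.
have BE : B.+1 = (e * c)%N by [].
pose I := {ffun 'I_r -> 'I_e}.
pose J := 'X_{1..M < B.+1}.
pose mon (f : I) : 'X_{1..r} := [multinom val (f i) | i < r].
have mon_inj : injective mon.
  move=> f g /mnmP efg; apply/ffunP => i; apply/val_inj.
  by have := efg i; rewrite !mnmE.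
have szX f : (msize ('X_[mon f] \mPo h) <= B.+1)%N.
  have hD i : (msize (tnth h i) <= D)%N.
    exact: (leq_bigmax_cond (F := fun i => msize (tnth h i))).
  have := msize_pred_prodX_le (mon f) hD.
  have : (mdeg (mon f) <= r * e)%N.
    have -> : (r * e = \sum_(i < r) e)%N by rewrite sum_nat_const card_ord.
    rewrite mdegE; apply: leq_sum => i _.
    by rewrite mnmE; apply: ltnW (ltn_ord _).
  move=> le1 le2; have le3 := leq_trans le2 (leq_mul le1 (leqnn D)).
  have rE : (r * e * D = e * (r * D))%N by rewrite mulnCA mulnA.
  rewrite BE /c mulnS; rewrite rE in le3.
  by apply: leq_trans (leqSpred _) _; rewrite -addn1 addnC leq_add.
have ltJI : (#|{: J}| < #|{: I}|)%N.
  apply: leq_ltn_trans (card_bmultinom_le _ _) _.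
  rewrite card_ffun !card_ord BE expnMn.
  apply: (@leq_trans (e ^ M.+1)); last by rewrite leq_pexp2l.
  by rewrite expnSr ltn_pmul2l ?expn_gt0 // /e ltnS.
pose A : 'M[K]_(#|{: I}|, #|{: J}|) :=
  \matrix_(a, b) ('X_[mon (enum_val a)] \mPo h)@_(enum_val b : J).
(* [A] has more rows than columns; a left kernel vector lists the coefficients of the relation. *)
have [u uN0 uA] : exists2 u : 'rV_#|{: I}|, u != 0 & u *m A = 0.
  have : kermx A != 0.
    by rewrite kermx_eq0 /row_free neq_ltn (leq_ltn_trans (rank_leq_col A)).
  move=> /rowV0Pn[u us uN0]; exists u => //; exact/sub_kermxP.
exists (\sum_a u 0 a *: 'X_[mon (enum_val a)]).
  apply: contra uN0 => /eqP e0; apply/eqP/rowP => a; rewrite mxE.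
  have := congr1 (mcoeff (mon (enum_val a))) e0.
  rewrite mcoeff0 raddf_sum /= (bigD1 a) //= mcoeffZ mcoeffX eqxx mulr1 big1 ?addr0 // => b ne.
  rewrite mcoeffZ mcoeffX (inj_eq mon_inj) (inj_eq enum_val_inj).
  by rewrite (negbTE ne) mulr0.
rewrite raddf_sum /=; apply/mpolyP => m; rewrite mcoeff0 raddf_sum /=.
have [ltm|gem] := ltnP (mdeg m) B.+1; last first.
  rewrite big1 // => a _; rewrite comp_mpolyZ mcoeffZ memN_msupp_eq0 ?mulr0 //.
  apply/negP => /msize_mdeg_lt; rewrite ltnNge => /negP; apply.
  exact: leq_trans gem.
have := congr1 (fun B : 'rV_#|{: J}| => B 0 (enum_rank (BMultinom ltm : J))) uA.
rewrite !mxE => e0; rewrite -[RHS]e0; apply: eq_bigr => a _.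
by rewrite comp_mpolyZ mcoeffZ mxE enum_rankK.
Qed.

End Multivariate.

(** * Zariski topology of projective space *)

Section ProjectiveSpace.
Local Open Scope ring_scope.
Local Open Scope classical_set_scope.
Variables (K : fieldType) (V : vectType K).
Hypothesis charK : [pchar K] =i pred0.
Local Notation N := (\dim {:V}).
Implicit Types (p : {mpoly K[N]}) (x : proj V) (v w : V) (A B C Z : set (proj V)).

Lemma hcoordZ a v i : hcoord (a *: v) i = a * hcoord v i.
Proof. by rewrite /hcoord linearZ. Qed.

Lemma hcoordD v w i : hcoord (v + w) i = hcoord v i + hcoord w i.
Proof. by rewrite /hcoord linearD. Qed.

Lemma hcoord_eq0 v : (forall i, hcoord v i = 0) -> v = 0.
Proof.
move=> v0; rewrite (coord_vbasis (memvf v)) big1 // => i _.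
by have := v0 i; rewrite /hcoord => ->; rewrite scale0r.
Qed.

Lemma dim_vline_neq0 v : v != 0 -> \dim <[v]> == 1%N.
Proof. by rewrite dim_vline => ->. Qed.

Definition proj_of v (vN0 : v != 0) : proj V := exist _ <[v]>%VS (dim_vline_neq0 vN0).

Lemma proj_lineP x : exists2 v, v != 0 & val x = <[v]>%VS.
Proof.
case: x => U /= dU; exists (vpick U); first by rewrite vpick0 -dimv_eq0 (eqP dU).
apply/eqP; rewrite eq_sym eqEdim dim_vline -memvE memv_pick (eqP dU).
by rewrite vpick0 -dimv_eq0 (eqP dU).
Qed.

Lemma vanishes_at_homog p d x v :
  p \is d.-homog -> val x = <[v]>%VS -> p.@[hcoord v] = 0 -> vanishes_at p x.
Proof.
move=> ph xv p0 w; rewrite xv => /vlineP[c ->] _.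
rewrite (meval_eq _ (v2 := fun i => c * hcoord v i)); last by move=> i; rewrite hcoordZ.
by rewrite (meval_homog_scale _ _ ph) p0 mulr0.
Qed.

Lemma vanishes_at_components p x d :
  vanishes_at p x -> vanishes_at (pihomog mdeg d p) x.
Proof.
move=> p0 v xv vN0.
have [ltd|ged] := ltnP d (msize p); last first.
  rewrite pihomogE big_seq_cond big1 ?meval0 // => m /andP[/msize_mdeg_lt ltm /eqP e].
  by move: ltm; rewrite ltnNge e ged.
apply: (sum_homog_eq0 charK (N := msize p) (f := fun d => pihomog mdeg d p) (e := 0)) => //.
  by move=> i; rewrite addn0; exact: pihomogP.
move=> t tN0; rewrite -pihomog_partitionE //.
rewrite (meval_eq _ (v2 := hcoord (t *: v))); last by move=> i; rewrite hcoordZ.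
by apply: p0; rewrite ?memvZ // scaler_eq0 negb_or tN0.
Qed.

Lemma vanishes_at_from_components p x :
  (forall d, vanishes_at (pihomog mdeg d p) x) -> vanishes_at p x.
Proof.
move=> p0 v xv vN0; rewrite (pihomog_partitionE (leqnn (msize p))) rmorph_sum big1 //=.
by move=> i _; apply: p0.
Qed.

Lemma zariski_closure_min A C : zariski_closed C -> A `<=` C -> zariski_closure A `<=` C.
Proof. by move=> cC AC x; apply. Qed.

Lemma sub_zariski_closure A : A `<=` zariski_closure A.
Proof. by move=> x Ax B [_]; apply. Qed.

(** Closed sets are cut out by homogeneous polynomials, so an arbitrary [p] is replaced by its
    homogeneous components. *)
Lemma vanishes_on_zariski_closure A p :
  (forall x, A x -> vanishes_at p x) ->
  forall x, zariski_closure A x -> vanishes_at p x.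
Proof.
move=> pA x Zx; apply: vanishes_at_from_components => d.
pose S : set {mpoly K[N]} := [set q | exists d, q = pihomog mdeg d p].
suff : [set x | forall q, S q -> vanishes_at q x] x by apply; exists d.
apply: zariski_closure_min Zx; last first.
  by move=> y /pA py q [e ->]; apply: vanishes_at_components.
exists S; split=> // q [e ->]; exists e; exact: pihomogP.
Qed.

Definition linear_subspace (U : {vspace V}) : set (proj V) :=
  [set x | (val x <= U)%VS].

Lemma linear_subspace_closed U : zariski_closed (linear_subspace U).
Proof.
(* Linear equations of [U]: the coordinates of [v - projv U v]. *)
pose l (i : 'I_N) : {mpoly K[N]} := \sum_(j < N)
  hcoord ((vbasis {:V})`_j - projv U (vbasis {:V})`_j) i *: 'X_j.
have lE i v : (l i).@[hcoord v] = hcoord (v - projv U v) i.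
  rewrite rmorph_sum /= [in RHS](coord_vbasis (memvf v)) linear_sum -sumrB /=.
  rewrite /hcoord linear_sum /=; apply: eq_bigr => j _.
  by rewrite mevalZ mevalXU linearZ /= -scalerBr linearZ /= mulrC.
exists [set p | exists i, p = l i]; split.
  move=> _ [i ->]; exists 1%N; rewrite /l rpred_sum // => j _.
  by apply: rpredZ; rewrite dhomogX /= mdeg1.
apply/seteqP; split=> x /= xU.
  move=> _ [i ->] v xv _; rewrite lE projv_id ?subrr ?/hcoord ?linear0 //.
  exact: (subvP xU).
apply/subvP => v xv; have [->|vN0] := eqVneq v 0; first exact: mem0v.
suff /eqP : v - projv U v = 0 by rewrite subr_eq0 => /eqP ->; apply: memv_proj.
by apply: hcoord_eq0 => i; rewrite -lE; apply: (xU _ _ v) => //; exists i.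
Qed.

Lemma not_vanishing Z C : zariski_closed Z -> ~ C `<=` Z ->
  exists p d x, [/\ p \is d.-homog, forall y, Z y -> vanishes_at p y, C x & ~ vanishes_at p x].
Proof.
case=> S [Sh ->] CZ; apply: contrapT => H; apply: CZ => x Cx p Sp.
apply: contrapT => px; apply: H; have [d pd] := Sh p Sp.
by exists p, d, x; split => // y; apply.
Qed.

Lemma line_poly_hcoord p v w : exists q : {poly K}, forall t, q.[t] = p.@[hcoord (v + t *: w)].
Proof.
have [q qE] := line_poly p (hcoord v) (hcoord w); exists q => t.
by rewrite qE; apply: meval_eq => i; rewrite hcoordD hcoordZ.
Qed.

(** If neither closed set contains the subspace, each misses a point of it at which some form
    vanishing on the set is nonzero. On the line joining two such points, some vector is a zero of
    neither form. *)
Lemma linear_subspace_irreducible U : U != 0%VS -> irreducible_closed (linear_subspace U).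
Proof.
move=> UN0; split; first exact: linear_subspace_closed.
  have vN0 : vpick U != 0 by rewrite vpick0.
  by exists (proj_of vN0); rewrite /linear_subspace /= -memvE memv_pick.
move=> A B cA cB UAB; apply: contrapT => /not_orP[nA nB].
have [p [d [x [ph pA xU px]]]] := not_vanishing cA nA.
have [q [e [y [qh qB yU qy]]]] := not_vanishing cB nB.
have [v vN0 xv] := proj_lineP x; have [w wN0 yw] := proj_lineP y.
have vU : v \in U by rewrite memvE -xv.
have wU : w \in U by rewrite memvE -yw.
have [P PE] := line_poly_hcoord p v (w - v).
have [Q QE] := line_poly_hcoord q v (w - v).
have [i vi] : exists i, hcoord v i != 0.
  apply: contrapT => H; case/eqP: vN0; apply: hcoord_eq0 => i.
  by apply/eqP/negPn/negP => vi; apply: H; exists i.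
(* [v] and [w] may be proportional, so the line can pass through 0; the coordinate polynomial [R]
   keeps the chosen vector nonzero. *)
have [R RE] := line_poly_hcoord 'X_i v (w - v).
have PQR : P * Q * R != 0.
  rewrite !mulf_neq0 //; apply/eqP => e0.
  - apply: px; apply: vanishes_at_homog ph xv _.
    by have := PE 0; rewrite e0 horner0 scale0r addr0.
  - apply: qy; apply: vanishes_at_homog qh yw _.
    by have := QE 1; rewrite e0 horner0 scale1r addrC subrK.
  - by have := RE 0; rewrite e0 horner0 scale0r addr0 mevalXU => /esym/eqP; apply/negP.
have [t] := poly_neq0_point charK PQR.
rewrite !hornerM !mulf_eq0 !negb_or PE QE RE; set u := v + _ => /andP[/andP[pu qu] ru].
have uN0 : u != 0 by apply: contra ru => /eqP ->; rewrite mevalXU /hcoord linear0.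
have : linear_subspace U (proj_of uN0).
  by rewrite /linear_subspace /= -memvE rpredD // rpredZ // rpredB.
have uu : u \in val (proj_of uN0) by exact: memv_line.
by case/UAB => [/pA/(_ u uu uN0)/eqP|/qB/(_ u uu uN0)/eqP]; apply/negP.
Qed.

End ProjectiveSpace.

(** * Krull dimension and algebraic independence *)

Section KrullDimension.
Local Open Scope ring_scope.
Local Open Scope classical_set_scope.
Variables (K : fieldType) (V : vectType K).
Hypothesis charK : [pchar K] =i pred0.
Local Notation N := (\dim {:V}).
Implicit Types (p f H : {mpoly K[N]}) (x : proj V) (v w : V) (A B C Z : set (proj V)).

Lemma linear_subspace_sub (U W : {vspace V}) :
  linear_subspace U `<=` linear_subspace W -> (U <= W)%VS.
Proof.
move=> UW; apply/subvP => v vU; have [->|vN0] := eqVneq v 0; first exact: mem0v.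
by have := UW (proj_of vN0); rewrite /linear_subspace /= -!memvE; apply.
Qed.

(** The chain is the projectivized flag of a basis; it starts with a point, hence the shift
    [i.+1]. *)
Lemma irreducible_chain_setT m : (m < N)%N -> irreducible_chain [set: proj V] m.
Proof.
move=> ltm; pose U i := <<take i.+1 (vbasis {:V})>>%VS.
have dU i : (i <= m)%N -> \dim (U i) = i.+1.
  move=> le; have fr : free (take i.+1 (vbasis {:V})).
    apply: (@catl_free _ _ (drop i.+1 (vbasis {:V}))); rewrite cat_take_drop.
    exact: basis_free (vbasisP _).
  by rewrite /U (eqP fr) size_takel // size_tuple (leq_trans _ ltm).
exists (fun i => linear_subspace (U i)); split=> [i lei|i lti].
  split => //; apply: linear_subspace_irreducible charK _ _.
  by rewrite -dimv_eq0 dU.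
split=> [x /= xU|/linear_subspace_sub /dimvS].
  apply: subv_trans xU _; apply: sub_span => v.
  by rewrite -(@take_takel _ i.+1 i.+2) //; apply: mem_take.
by rewrite !dU ?ltnn // ltnW.
Qed.

Lemma irreducible_chain_point Z x : Z x -> irreducible_chain Z 0.
Proof.
move=> Zx; exists (fun=> linear_subspace (val x)); split=> // i _; split.
  apply: linear_subspace_irreducible charK _ _.
  by rewrite -dimv_eq0; case: x {Zx} => U /= /eqP ->.
move=> y /= yx; suff -> : y = x by [].
apply/val_inj/eqP; rewrite eqEdim yx.
by case: x {Zx yx} => U /= /eqP ->; case: y => W /= /eqP ->.
Qed.

(* The [g i] are algebraically independent as functions on the cone over [C]. *)
Definition alg_indep_on C r (g : r.-tuple {mpoly K[N]}) :=
  forall P : {mpoly K[r]}, (forall x, C x -> vanishes_at (P \mPo g) x) -> P = 0.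

Lemma hypersurface_closed p d : p \is d.-homog -> zariski_closed [set x | vanishes_at p x].
Proof.
move=> ph; exists [set p]; split; first by move=> _ ->; exists d.
by apply/seteqP; split=> x /=; [move=> px _ -> | apply].
Qed.

(** The coordinate ring of the cone over an irreducible set is a domain. As [H] is arbitrary,
    irreducibility is applied to each of its homogeneous components. *)
Lemma irreducible_cancel C f d H : irreducible_closed C -> f \is d.-homog ->
  ~ (forall x, C x -> vanishes_at f x) ->
  (forall x, C x -> vanishes_at (H * f) x) -> forall x, C x -> vanishes_at H x.
Proof.
case=> _ _ irrC fh fC HfC x Cx; apply: vanishes_at_from_components => e.
have Heh : pihomog mdeg e H \is e.-homog by exact: pihomogP.
have [] := irrC _ _ (hypersurface_closed Heh) (hypersurface_closed fh); last 2 first.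
- by move/(_ x Cx).
- by move=> Cf; case: fC.
move=> y Cy /=; have [v vN0 yv] := proj_lineP y.
suff /eqP : (pihomog mdeg e H * f).@[hcoord v] = 0.
  rewrite mevalM mulf_eq0 => /orP[] /eqP e0; [left|right].
    exact: vanishes_at_homog Heh yv e0.
  exact: vanishes_at_homog fh yv e0.
have [lte|gee] := ltnP e (msize H); last first.
  rewrite pihomogE big_seq_cond big1 ?mul0r ?meval0 // => m /andP[/msize_mdeg_lt ltm /eqP em].
  by move: ltm; rewrite ltnNge em gee.
(* Multiplying the components of [H] by [f] gives the components of [H * f], in degrees shifted by
   [d]. *)
apply: (sum_homog_eq0 charK (N := msize H) (f := fun e => pihomog mdeg e H * f) (e := d)) => //.
  by move=> i; apply: dhomogM => //; exact: pihomogP.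
move=> t tN0; rewrite -mulr_suml -pihomog_partitionE //.
rewrite (meval_eq _ (v2 := hcoord (t *: v))); last by move=> i; rewrite hcoordZ.
apply: (HfC y Cy); last by rewrite scaler_eq0 negb_or tN0.
by rewrite yv memvZ // memv_line.
Qed.

Lemma comp_mpoly_muni r (P : {mpoly K[r.+1]}) (g : r.-tuple {mpoly K[N]}) f :
  P \mPo [tuple of rcons g f] = (map_poly (comp_mpoly g) (muni P)).[f].
Proof.
apply/eqP; rewrite -subr_eq0; apply/eqP/(mpoly_eq0_fun charK) => v; apply/eqP.
rewrite mevalB subr_eq0 comp_mpoly_meval meval_muni -horner_map -map_poly_comp /=.
have -> : (tnth [tuple of rcons g f] ord_max).@[v] = f.@[v].
  by rewrite (tnth_nth 0) /= nth_rcons size_tuple ltnn eqxx.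
apply/eqP; congr (_.[_]); apply: eq_map_poly => q /=.
rewrite comp_mpoly_meval; apply: meval_eq => i.
by rewrite (tnth_nth 0) /= nth_rcons size_tuple ltn_ord -tnth_nth.
Qed.

(** View [P] as a polynomial in its last variable, evaluated at [f]. On [C'] only the constant term
    survives, so it is 0 by independence; then one factor [f] is cancelled on [C], and induction
    finishes. *)
Lemma alg_indep_on_rcons C C' r (g : r.-tuple {mpoly K[N]}) f d :
  C' `<=` C -> irreducible_closed C -> f \is d.-homog ->
  (forall x, C' x -> vanishes_at f x) -> ~ (forall x, C x -> vanishes_at f x) ->
  alg_indep_on C' g -> alg_indep_on C [tuple of rcons g f].
Proof.
move=> CC irrC fh fC' fC indep P; rewrite comp_mpoly_muni => PC.
apply: muni_eq0; elim/poly_ind: (muni P) PC => // p c IHp.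
rewrite rmorphD rmorphM /= map_polyX map_polyC /= hornerD hornerMX hornerC => pcC.
have c0 : c = 0.
  apply: indep => x C'x v xv vN0; have := pcC x (CC _ C'x) v xv vN0.
  by rewrite mevalD mevalM (fC' x C'x v xv vN0) mulr0 add0r.
rewrite {}c0 comp_mpoly0 addr0 in pcC *.
by rewrite IHp ?mul0r ?addr0 //; apply: irreducible_cancel irrC fh fC _.
Qed.

(** A coordinate that is nonzero at the point takes every value on the corresponding line of the
    cone. *)
Lemma alg_indep_on_point C : C !=set0 -> exists g : 1.-tuple {mpoly K[N]}, alg_indep_on C g.
Proof.
case=> x Cx; have [v vN0 xv] := proj_lineP x.
have [i vi] : exists i, hcoord v i != 0.
  apply: contrapT => H; case/eqP: vN0; apply: hcoord_eq0 => i.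
  by apply/eqP/negPn/negP => vi; apply: H; exists i.
exists [tuple 'X_i] => P PC; have [q qE] := line_poly P (fun=> 0) (fun=> 1).
have q0 : q = 0.
  apply: (poly_eq0_nonzero_roots charK) => t tN0.
  have cN0 : t / hcoord v i != 0 by rewrite mulf_neq0 ?invr_eq0.
  have := PC x Cx ((t / hcoord v i) *: v); rewrite xv memvZ ?memv_line // scaler_eq0.
  rewrite negb_or cN0 vN0 comp_mpoly_meval => /(_ isT isT) e0; rewrite -[RHS]e0 qE.
  apply: meval_eq => j; rewrite ord1 (tnth_nth 0) /= mevalXU hcoordZ divfK //.
  by rewrite add0r mulr1.
apply: (mpoly_eq0_fun charK) => w; have := qE (w 0); rewrite q0 horner0 => e0.
by rewrite [RHS]e0; apply: meval_eq => j; rewrite ord1 add0r mulr1.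
Qed.

(** The smallest set contributes one polynomial, and every strict inclusion adds a form that
    vanishes on the smaller set but not on the larger. *)
Lemma chain_alg_indep Z m : irreducible_chain Z m ->
  exists2 C, C `<=` Z & exists g : m.+1.-tuple {mpoly K[N]}, alg_indep_on C g.
Proof.
case=> C [irrC ltC]; exists (C m); first by have [] := irrC m (leqnn m).
suff : forall i, (i <= m)%N -> exists g : i.+1.-tuple {mpoly K[N]}, alg_indep_on (C i) g.
  exact.
elim=> [|i IHi] lti; first by apply: alg_indep_on_point; have [[]] := irrC 0%N lti.
have [g gi] := IHi (ltnW lti); have [CC CN] := ltC i lti.
have [[cl _ _] _] := irrC i (ltnW lti).
have [f [d [x [fh fC Cx fx]]]] := not_vanishing cl CN.
exists [tuple of rcons g f]; apply: alg_indep_on_rcons CC _ fh fC _ gi.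
  by have [] := irrC i.+1 lti.
by move=> /(_ x Cx).
Qed.

End KrullDimension.

(** * Three or more summands *)

Section ThreeSummands.
Local Open Scope ring_scope.
Local Open Scope classical_set_scope.
Variable K : closedFieldType.
Variable k : nat.
Implicit Types (G F : {mpoly K[3]}) (L : nat -> {mpoly K[3]}).

(** The set whose closure is [secant_osculating s k 2 (k + 2)]. *)
Definition secant_points (s : nat) : set (proj (form K 2 (k + 2))) :=
  [set x | exists u : 'I_s -> proj (form K 2 (k + 2)),
     (forall i, @osculating_variety K k 2 (k + 2) (u i)) /\
     (val x <= \sum_(i < s) val (u i))%VS].

(** The osculating variety demands a nonzero cofactor. For [F = 0] the product is the zero vector,
    which lies on every line, so the cofactor ['X_0 ^+ k] serves instead. *)
Lemma osculating_point (L F : {mpoly K[3]}) : L != 0 -> L \is 1.-homog -> F \is k.-homog ->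
  exists2 x, @osculating_variety K k 2 (k + 2) x &
    forall G : form K 2 (k + 2), (G : {mpoly K[3]}) = L ^+ 2 * F -> G \in val x.
Proof.
move=> LN0 Lh; wlog FN0 : F / F != 0.
  move=> H Fh; have [F0|] := eqVneq F 0; last by move/H; apply.
  have XN0 : 'X_0 ^+ k != 0 :> {mpoly K[3]} by rewrite expf_neq0 // -msize_poly_eq0 msizeX.
  have Xh : 'X_0 ^+ k \is [in K[3], k.-homog] by rewrite mpolyXn dhomogX /= mdegMn mdeg1 mul1n.
  have [x ox _] := H _ XN0 Xh.
  by exists x => // G; rewrite F0 mulr0 => G0; have -> : G = 0; [exact: val_inj | exact: mem0v].
move=> Fh; have LFh : L ^+ 2 * F \is (k + 2).-homog.
  by rewrite addnC; apply: dhomogM => //; apply: (dhomogMn 2 Lh).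
have GN0 : DHomog LFh != 0.
  apply/eqP => /(congr1 val) /= /eqP; apply/negP; rewrite mulf_neq0 // expf_neq0 //.
exists (proj_of GN0) => [|G GE].
  exists (DHomog Lh), (DHomog Fh), (DHomog LFh); split=> //.
  by rewrite addKn.
by suff -> : G = DHomog LFh; [exact: memv_line | exact: val_inj].
Qed.

(** The part of degree [k + 2] of the ideal generated by three squares, when the [L i] are linear
    forms. *)
Definition squares_ideal L G := exists F : nat -> {mpoly K[3]},
  (forall i, F i \is k.-homog) /\ G = \sum_(i < 3) L i ^+ 2 * F i.

Lemma secant_points_sum L s x (G : form K 2 (k + 2)) : (3 <= s)%N ->
  (forall i, L i != 0) -> (forall i, L i \is 1.-homog) ->
  squares_ideal L G -> val x = <[G]>%VS -> secant_points s x.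
Proof.
move=> s3 LN0 Lh [F [Fh GE]] xG.
(* Summands from the fourth on are 0. *)
pose F' i := if (i < 3)%N then F i else 0.
have F'h i : F' i \is k.-homog by rewrite /F'; case: ifP => // _; apply: rpred0.
have /choice[u uP] : forall i : 'I_s, exists y : proj (form K 2 (k + 2)),
    @osculating_variety K k 2 (k + 2) y /\
    forall G : form K 2 (k + 2), (G : {mpoly K[3]}) = L i ^+ 2 * F' i -> G \in val y.
  by move=> i; have [y] := osculating_point (LN0 i) (Lh i) (F'h i); exists y.
exists u; split=> [i|]; first by case: (uP i).
have Gh i : L i ^+ 2 * F' i \is (k + 2).-homog.
  by rewrite addnC; apply: dhomogM => //; apply: (dhomogMn 2 (Lh i)).
have -> : val x = <[\sum_(i < s) (DHomog (Gh i) : form K 2 (k + 2))]>%VS.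
  rewrite xG; congr <[_]>%VS; apply/val_inj; rewrite /= raddf_sum /= GE.
  rewrite (big_ord_widen s (fun i => L i ^+ 2 * F i) s3) big_mkcond /=.
  by apply: eq_bigr => i _; rewrite /F'; case: ifP => //; rewrite mulr0.
rewrite -memvE; apply: memv_sumr => i _.
by have [_] := uP i; apply.
Qed.

Lemma squares_ideal_add L G G' : squares_ideal L G -> squares_ideal L G' ->
  squares_ideal L (G + G').
Proof.
move=> [F [Fh ->]] [F' [F'h ->]]; exists (fun i => F i + F' i); split.
  by move=> i; apply: rpredD.
by rewrite -big_split; apply: eq_bigr => i _; rewrite mulrDr.
Qed.

Lemma squares_ideal_scale L c G : squares_ideal L G -> squares_ideal L (c *: G).
Proof.
move=> [F [Fh ->]]; exists (fun i => c *: F i); split.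
  by move=> i; apply: rpredZ.
by rewrite scaler_sumr; apply: eq_bigr => i _; rewrite scalerAr.
Qed.

Lemma squares_ideal_mul L i F : (i < 3)%N -> F \is k.-homog -> squares_ideal L (L i ^+ 2 * F).
Proof.
move=> lti Fh; exists (fun j => if j == i then F else 0); split.
  by move=> j; case: ifP => // _; apply: rpred0.
rewrite (bigD1 (Ordinal lti)) //= eqxx big1 ?addr0 // => j; rewrite -val_eqE /= => /negbTE ->.
by rewrite mulr0.
Qed.

Lemma squares_ideal_msupp L G : (forall m, m \in msupp G -> squares_ideal L 'X_[m]) ->
  squares_ideal L G.
Proof.
move=> H; rewrite [G]mpolyE big_seq; elim/big_ind: _ => [||m /H].
- by exists (fun=> 0); split=> [i|]; [apply: rpred0 | rewrite big1 // => i _; rewrite mulr0].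
- by move=> *; apply: squares_ideal_add.
exact: squares_ideal_scale.
Qed.

Lemma squares_ideal_monomial L (i : 'I_3) (m : 'X_{1..3}) :
  L i = 'X_i -> mdeg m = (k + 2)%N -> (2 <= m i)%N ->
  squares_ideal L 'X_[m].
Proof.
move=> Li dm mi; have le : (U_(i) *+ 2 <= m)%MM.
  by apply/mnm_lepP => j; rewrite mulmnE mnm1E; case: eqP => [<-|]; rewrite ?mul1n.
rewrite -(submK le) addmC mpolyXD -mpolyXn -Li; apply: squares_ideal_mul => //.
rewrite dhomogX /= -(eqn_add2r (mdeg (U_(i) *+ 2))%MM) -mdegD submK //.
by rewrite mdegMn mdeg1 dm mul1n.
Qed.

Definition lin3 (i : nat) : {mpoly K[3]} := 'X_(inord i).

(** A squarefree monomial in three variables has degree at most 3, with equality only for the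
    product of all three, while [k + 2 >= 3]. *)
Lemma monomial_square m : mdeg m = (k + 2)%N -> (1 <= k)%N -> m != [multinom 1%N | i < 3] ->
  exists i : 'I_3, (2 <= m i)%N.
Proof.
move=> dm k1 mN1; apply: contrapT => H; case/eqP: mN1; apply/mnmP => j; rewrite mnmE.
have lt2 i : (m i <= 1)%N by rewrite leqNgt; apply/negP => lt; apply: H; exists i.
move: dm; rewrite mdegE (bigD1 j) //=.
set b := (X in (m j + X)%N); have le2 : (b <= 2)%N.
  apply: (@leq_trans (\sum_(i < 3 | i != j) 1)); first by apply: leq_sum => i _; apply: lt2.
  by rewrite sum1_card cardC1 card_ord.
have := lt2 j; move: (m j) b le2 k1 => a b le2 k1 le1 e; lia.
Qed.

Lemma squares_ideal_generic G : (1 <= k)%N -> G \is (k + 2).-homog ->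
  G@_[multinom 1%N | i < 3] = 0 ->
  squares_ideal lin3 G.
Proof.
move=> k1 /dhomogP Gh G1; apply: squares_ideal_msupp => m mG.
have [|i mi] := monomial_square (Gh m mG : mdeg m = _) k1.
  by apply: contraTneq mG => ->; rewrite mcoeff_msupp G1 eqxx.
by apply: (squares_ideal_monomial (i := i)) => //; [rewrite /lin3 inord_val | exact: Gh].
Qed.

Lemma secant_points_generic s x (G : form K 2 (k + 2)) : (3 <= s)%N -> (1 <= k)%N ->
  val x = <[G]>%VS -> (G : {mpoly K[3]})@_[multinom 1%N | i < 3] = 0 -> secant_points s x.
Proof.
move=> s3 k1 xG G1; apply: (@secant_points_sum lin3) xG => //.
- by move=> i; rewrite -msize_poly_eq0 msizeX.
- by move=> i; rewrite /lin3 dhomogX /= mdeg1.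
- exact: squares_ideal_generic (dhomog_is_dhomog G) _.
Qed.

End ThreeSummands.

(** * Plane cubics, the case [k = 1] *)

Section PlaneCubics.
Local Open Scope ring_scope.
Local Open Scope classical_set_scope.
Variable K : closedFieldType.
Hypothesis charK : [pchar K] =i pred0.
Implicit Types (G F : {mpoly K[3]}).

Definition m111 : 'X_{1..3} := [multinom 1%N | i < 3].
Definition m210 : 'X_{1..3} := [multinom (2 - i)%N | i < 3].
Local Notation x0 := ('X_(inord 0) : {mpoly K[3]}).
Local Notation x1 := ('X_(inord 1) : {mpoly K[3]}).
Local Notation x2 := ('X_(inord 2) : {mpoly K[3]}).

Lemma mpolyX3 (m : 'X_{1..3}) :
  'X_[m] = x0 ^+ m (inord 0) * x1 ^+ m (inord 1) * x2 ^+ m (inord 2).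
Proof.
rewrite mpolyXE_id !big_ord_recl big_ord0 mulr1 mulrA.
have -> : inord 0 = ord0 :> 'I_3 by apply/val_inj; rewrite /= inordK.
have -> : inord 1 = lift ord0 ord0 :> 'I_3 by apply/val_inj; rewrite /= inordK.
by have -> : inord 2 = lift ord0 (lift ord0 ord0) :> 'I_3 by apply/val_inj; rewrite /= inordK.
Qed.

Definition shifted_lin (b : K) (i : nat) : {mpoly K[3]} :=
  if i == 0%N then x0 + b%:MP * x2 else lin3 K i.

Lemma X_homog (i : 'I_3) : ('X_i : {mpoly K[3]}) \is 1.-homog.
Proof. by rewrite dhomogX /= mdeg1. Qed.

Lemma shifted_homog b i : shifted_lin b i \is 1.-homog.
Proof.
rewrite /shifted_lin /lin3; case: ifP => _; last exact: X_homog.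
by rewrite mul_mpolyC rpredD ?rpredZ ?X_homog.
Qed.

Lemma shifted_neq0 b i : shifted_lin b i != 0.
Proof.
rewrite /shifted_lin /lin3; case: ifP => _; last by rewrite -msize_poly_eq0 msizeX.
apply/eqP => /(congr1 (mcoeff U_(inord 0))); rewrite mcoeff0 mcoeffD mcoeffCM !mcoeffX eqxx.
have -> : (U_(inord 2) == U_(inord 0) :> 'X_{1..3})%MM = false.
  apply/eqP => /mnmP/(_ (inord 2)); rewrite !mnm1E eqxx.
  by rewrite -val_eqE /= !inordK.
by rewrite mulr0 addr0 => /eqP; rewrite oner_eq0.
Qed.

(** With [a] the coefficient at [m210], [b] makes [a * (x0 + b * x2) ^ 2 * x1] agree with [G] at
    [x0 ^ 2 * x1] and at [x0 * x1 * x2]; its only other term is divisible by [x2 ^ 2]. *)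
Lemma squares_ideal_cubic G (b := G@_m111 / (2 * G@_m210)) : G \is 3.-homog -> G@_m210 != 0 ->
  squares_ideal 1 (shifted_lin b) G.
Proof.
move=> Gh aN0; set a := G@_m210 in b aN0 *; set L := shifted_lin b.
have Xh := X_homog.
have L1 : L 1%N = x1 by [].
have L2 : L 2%N = x2 by [].
have L0 : L 0%N = x0 + b%:MP * x2 by [].
have L0h : L 0%N \is 1.-homog by apply: shifted_homog.
have Ch c F : F \is 1.-homog -> c%:MP * F \is 1.-homog by move=> Fh; rewrite mul_mpolyC rpredZ.
have cE : G@_m111 = 2 * a * b.
  have two : 2 != 0 :> K by move/pcharf0P: charK => ->.
  by rewrite /b; field; apply/andP.
have mE : m210 != m111.
  by apply/eqP => /mnmP/(_ (inord 0)); rewrite /m210 /m111 !mnmE inordK.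
pose H := G - a *: 'X_[m210] - G@_m111 *: 'X_[m111].
have -> : G = (a *: 'X_[m210] + G@_m111 *: 'X_[m111]) + H.
  by rewrite addrC /H -[G - _ - _]addrA -opprD subrK.
have m210E : m210 (inord 0) = 2%N /\ m210 (inord 1) = 1%N /\ m210 (inord 2) = 0%N.
  by rewrite /m210 !mnmE !inordK.
have m111E i : m111 i = 1%N by rewrite mnmE.
apply: squares_ideal_add.
  rewrite cE (mpolyX3 m210) (mpolyX3 m111) !m111E; case: m210E => -> [-> ->].
  have -> : a *: (x0 ^+ 2 * x1 ^+ 1 * x2 ^+ 0) + (2 * a * b) *: (x0 ^+ 1 * x1 ^+ 1 * x2 ^+ 1)
     = L 0%N ^+ 2 * (a%:MP * x1) + L 2%N ^+ 2 * ((- (a * b ^+ 2))%:MP * x1).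
    rewrite L0 L2 -!mul_mpolyC; ring.
  by apply: squares_ideal_add; apply: squares_ideal_mul => //; apply: Ch; apply: Xh.
have Hh : H \is 3.-homog.
  by rewrite /H !rpredB // rpredZ // dhomogX /= mdegE !big_ord_recl big_ord0 !mnmE.
have H210 : H@_m210 = 0.
  by rewrite !mcoeffB !mcoeffZ !mcoeffX eqxx eq_sym (negbTE mE) mulr1 subrr mulr0 subr0.
have H111 : H@_m111 = 0.
  by rewrite !mcoeffB !mcoeffZ !mcoeffX eqxx (negbTE mE) mulr1 mulr0 subr0 subrr.
(* A monomial of [H] divisible by neither [x1 ^ 2] nor [x2 ^ 2] is [x0 ^ 3] or [x0 ^ 2 * x2]. Modulo
   [x2 ^ 2] both are multiples of [(x0 + b * x2) ^ 2]. *)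
apply: squares_ideal_msupp => m mH; have dm : mdeg m = 3%N := dhomog_mf Hh mH.
have [m1|m1] := ltnP 1 (m (inord 1)).
  by apply: (squares_ideal_monomial (i := inord 1)) => //; rewrite inordK.
have [m2|m2] := ltnP 1 (m (inord 2)).
  by apply: (squares_ideal_monomial (i := inord 2)) => //; rewrite inordK.
have m_eq (m' : 'X_{1..3}) : m (inord 0) = m' (inord 0) -> m (inord 1) = m' (inord 1) ->
    m (inord 2) = m' (inord 2) -> m = m'.
  move=> e0 e1 e2; apply/mnmP => i; rewrite -[i]inord_val.
  by case: i => [[|[|[|//]]] /= _].
have dm3 : (m (inord 0) + m (inord 1) + m (inord 2) = 3)%N.
  apply: etrans _ dm; rewrite mdegE !big_ord_recl big_ord0 addn0 addnA.
  by congr (m _ + m _ + m _)%N; apply/val_inj; rewrite /= inordK.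
rewrite (mpolyX3 m); case e1 : (m (inord 1)) m1 => [|[|//]] _; last first.
  case e2 : (m (inord 2)) m2 => [|[|//]] _; rewrite e1 e2 ?addn1 ?addn0 in dm3;
    case: dm3 => e0.
    have mm : m = m210 by case: m210E => f0 [f1 f2]; apply: m_eq; rewrite ?f0 ?f1 ?f2.
    by move: mH; rewrite mm mcoeff_msupp H210 eqxx.
  have mm : m = m111 by apply: m_eq; rewrite m111E.
  by move: mH; rewrite mm mcoeff_msupp H111 eqxx.
case e2 : (m (inord 2)) m2 => [|[|//]] _; rewrite e1 e2 ?addn1 ?addn0 in dm3.
  rewrite dm3.
  have -> : x0 ^+ 3 * x1 ^+ 0 * x2 ^+ 0 = L 0%N ^+ 2 * (L 0%N + (- (3 * b))%:MP * x2) +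
     L 2%N ^+ 2 * ((3 * b ^+ 2)%:MP * L 0%N + (- b ^+ 3)%:MP * x2).
    rewrite L0 L2; ring.
  by apply: squares_ideal_add; apply: squares_ideal_mul => //; rewrite rpredD ?Ch.
case: dm3 => ->.
have -> : x0 ^+ 2 * x1 ^+ 0 * x2 ^+ 1 = L 0%N ^+ 2 * x2 +
     L 2%N ^+ 2 * ((- (2 * b))%:MP * L 0%N + (b ^+ 2)%:MP * x2).
  rewrite L0 L2; ring.
by apply: squares_ideal_add; apply: squares_ideal_mul => //; rewrite ?Xh // rpredD ?Ch.
Qed.

End PlaneCubics.

(** * Density and the absence of defect *)

Section Filling.
Local Open Scope ring_scope.
Local Open Scope classical_set_scope.
Variable K : closedFieldType.
Hypothesis charK : [pchar K] =i pred0.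

Lemma secant_points_cubic s x (G : form K 2 (1 + 2)) : (3 <= s)%N ->
  val x = <[G]>%VS -> (G : {mpoly K[3]})@_m210 != 0 -> @secant_points K 1 s x.
Proof.
move=> s3 xG aN0.
have := squares_ideal_cubic charK (dhomog_is_dhomog G) aN0; set b := _ / _ => sosG.
exact: secant_points_sum s3 (shifted_neq0 b) (shifted_homog b) sosG xG.
Qed.

Lemma secant_cubics_dense s x : (3 <= s)%N -> zariski_closure (@secant_points K 1 s) x.
Proof.
move=> s3 B [[S [Sh ->]] AB] p Sp.
have [G GN0 xG] := proj_lineP x.
have [e ph] := Sh p Sp; apply: (vanishes_at_homog ph xG).
have Mh : 'X_[m210] \is [in K[3], (1 + 2).-homog].
  by rewrite dhomogX /= mdegE !big_ord_recl big_ord0 !mnmE.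
pose M : form K 2 (1 + 2) := DHomog Mh; pose a := (G : {mpoly K[3]})@_m210.
(* The form at [t] on this line has coefficient [t] at [m210], so it is a secant point for [t != 0];
   [t = a] recovers [G], even if [a = 0]. *)
have [q qE] := line_poly_hcoord p (G - a *: M) M.
suff q0 : q = 0 by have := qE a; rewrite q0 horner0 subrK => <-.
apply: (poly_eq0_nonzero_roots charK) => t tN0; rewrite qE; set Gt := _ + _.
have Gt210 : (Gt : {mpoly K[3]})@_m210 = t.
  by rewrite /= mcoeffD mcoeffB !mcoeffZ !mcoeffX eqxx !mulr1 subrr add0r.
have GtN0 : Gt != 0.
  by apply/eqP => G0; case/eqP: tN0; rewrite -Gt210 G0 mcoeff0.
have : @secant_points K 1 s (proj_of GtN0).
  by apply: secant_points_cubic s3 _ _; [reflexivity | rewrite Gt210].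
by move/AB/(_ p Sp Gt); apply=> //; exact: memv_line.
Qed.

(** If the coefficient at [m111] is 0, the form is itself a secant point; otherwise its degree is 3,
    so [k = 1] and density applies. *)
Lemma secant_osculating_full k s x : (1 <= k)%N -> (3 <= s)%N ->
  @secant_osculating K s k 2 (k + 2) x.
Proof.
move=> k1 s3; have [G GN0 xG] := proj_lineP x.
have [G1|G1] := eqVneq ((G : {mpoly K[3]})@_m111) 0.
  by apply: sub_zariski_closure; apply: secant_points_generic xG G1.
have k_eq1 : k = 1%N.
  apply/eqP; rewrite -(eqn_add2r 2); apply: contraNT G1 => kN1; apply/eqP.
  apply: (dhomog_nemf_coeff (dhomog_is_dhomog G)).
  by rewrite /= mdegE !big_ord_recl big_ord0 !mnmE eq_sym.
subst k; exact: secant_cubics_dense.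
Qed.

Lemma expdim_le k s : (@expdim s k 2 (k + 2) < \dim {: form K 2 (k + 2)})%N.
Proof.
have -> : \dim {: form K 2 (k + 2)} = 'C(k + 2 + 2, k + 2).
  by rewrite dimvf.
have -> : 'C(k + 2 + 2, k + 2) = 'C(2 + (k + 2), 2).
  by rewrite -bin_sub ?leq_addr // addKn addnC.
rewrite /expdim; apply: (@leq_ltn_trans ('C(2 + (k + 2), 2) - 1)); first exact: geq_minl.
by rewrite subn1 prednK // bin_gt0 leq_addr.
Qed.

Lemma not_defective k s : (1 <= k)%N -> (3 <= s)%N -> ~ defective K s k 2 (k + 2).
Proof.
(* A chain of length [expdim] contradicts the maximality of [m]. *)
move=> k1 s3 [m [_ max_m]]; rewrite ltnNge => /negP; apply; apply: max_m.
have -> : @secant_osculating K s k 2 (k + 2) = [set: _].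
  by apply/seteqP; split=> // x _; apply: secant_osculating_full.
exact: (irreducible_chain_setT charK (expdim_le k s)).
Qed.

End Filling.

(** * Two summands *)

Section SingularForms.
Local Open Scope ring_scope.
Local Open Scope classical_set_scope.
Variable K : closedFieldType.
Hypothesis charK : [pchar K] =i pred0.
Variable k : nat.
Implicit Types (G F H L : {mpoly K[3]}) (i j : 'I_3) (p : 'I_3 -> K).

(** The substitution carrying the [i]-th coordinate point to [p], normalised by [p i = 1]. The ring
    is general so that the entries of [p] can also be parameters. *)
Definition shear (R : comNzRingType) i (p : 'I_3 -> R) : 3.-tuple {mpoly R[3]} :=
  [tuple 'X_j + (if j == i then 0 else p j) *: 'X_i | j < 3].

Lemma comp_mpoly_homog n r d (h : n.-tuple {mpoly K[r]}) (F : {mpoly K[n]}) :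
  (forall l, tnth h l \is 1.-homog) -> F \is d.-homog -> F \mPo h \is d.-homog.
Proof.
move=> hh /dhomogP Fh; rewrite comp_mpolyE big_seq rpred_sum // => m mF; apply: rpredZ.
have <- : mdeg m = d := Fh m mF.
rewrite mdegE; elim/big_ind2: _ => [|q a r' b|i _]; first exact: dhomog1.
  exact: dhomogM.
by have := dhomogMn (m i) (hh i); rewrite mul1n.
Qed.

Lemma shear_homog i p j : tnth (shear i p) j \is 1.-homog.
Proof. by rewrite tnth_mktuple rpredD ?rpredZ ?X_homog. Qed.

Lemma meval_shear i p j v :
  (tnth (shear i p) j).@[v] = v j + (if j == i then 0 else p j) * v i.
Proof. by rewrite tnth_mktuple mevalD mevalZ !mevalXU. Qed.

Lemma shearK i p F : (F \mPo shear i p) \mPo shear i (fun j => - p j) = F.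
Proof.
apply/eqP; rewrite -subr_eq0; apply/eqP/(mpoly_eq0_fun charK) => v; apply/eqP.
rewrite mevalB subr_eq0 !comp_mpoly_meval; apply/eqP; apply: meval_eq => j.
rewrite meval_shear !meval_shear eqxx mul0r addr0.
by case: eqP => [->|_]; ring.
Qed.

Lemma linear_form_eq L : L \is 1.-homog -> L = \sum_j L@_U_(j) *: 'X_j.
Proof.
move=> Lh; apply/mpolyP => m; rewrite raddf_sum /=.
have [dm|dm] := eqVneq (mdeg m) 1%N; last first.
  rewrite (dhomog_nemf_coeff Lh dm) big1 // => j _; rewrite mcoeffZ mcoeffX.
  case: eqP => [e|]; last by rewrite mulr0.
  by move: dm; rewrite -e mdeg1 eqxx.
have /mdeg1P[i /eqP ->] : mdeg m == 1%N by rewrite dm.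
rewrite (bigD1 i) //= mcoeffZ mcoeffX eqxx mulr1 big1 ?addr0 // => j ji.
rewrite mcoeffZ mcoeffX; case: eqP => [/mnmP/(_ i)|]; last by rewrite mulr0.
by rewrite !mnm1E eqxx (negbTE ji).
Qed.

Lemma shear_linear_form i p L : L \is 1.-homog -> p i = 1 -> L.@[p] = 0 ->
  L \mPo shear i p = \sum_(j | j != i) L@_U_(j) *: 'X_j.
Proof.
move=> Lh pi Lp; apply/eqP; rewrite -subr_eq0; apply/eqP/(mpoly_eq0_fun charK) => v; apply/eqP.
rewrite mevalB subr_eq0 comp_mpoly_meval.
have LE w : L.@[w] = \sum_j L@_U_(j) * w j.
  rewrite {1}(linear_form_eq Lh) rmorph_sum; apply: eq_bigr => j _.
  by rewrite /= mevalZ mevalXU.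
move: Lp; rewrite !LE rmorph_sum /= (bigD1 i) //= pi mulr1 => /eqP.
rewrite addr_eq0 => /eqP Li.
rewrite (bigD1 i) //= meval_shear eqxx mul0r addr0 Li mulNr mulr_suml -sumrN -big_split /=.
apply/eqP/eq_bigr => j ji; rewrite meval_shear (negbTE ji) mevalZ mevalXU; ring.
Qed.

(** The shear makes [L] free of ['X_i], so only [F], of degree [k], contributes to the exponent of
    ['X_i]. In degree [k + 2] this bound says that the form is singular at the coordinate point. *)
Lemma square_times_support i p L F (m : 'X_{1..3}) :
  L \is 1.-homog -> F \is k.-homog -> p i = 1 -> L.@[p] = 0 ->
  (k < m i)%N -> ((L ^+ 2 * F) \mPo shear i p)@_m = 0.
Proof.
move=> Lh Fh pi Lp km; apply: memN_msupp_eq0; apply: contraL km; rewrite -leqNgt.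
rewrite rmorphM rmorphXn /= expr2.
have L_i m' : m' \in msupp (L \mPo shear i p) -> m' i = 0%N.
  rewrite (shear_linear_form Lh pi Lp) mcoeff_msupp; apply: contraNeq => m'i.
  rewrite raddf_sum big1 //= => j ji; rewrite mcoeffZ mcoeffX.
  case: eqP => [e|]; last by rewrite mulr0.
  by move: m'i; rewrite -e mnm1E (negbTE ji).
move/msuppM_le/allpairsP => [[m1 m2] /= [/msuppM_le/allpairsP[[m3 m4] /= [s3 s4 ->]] s2 ->]].
rewrite !mnmDE (L_i m3) // (L_i m4) // !add0n.
have <- : mdeg m2 = k := dhomog_mf (comp_mpoly_homog (shear_homog i p) Fh) s2.
by rewrite mdegE (bigD1 i) //= leq_addr.
Qed.

(** Two linear equations in three unknowns have a nonzero solution; dividing by a nonzero coordinate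
    normalises it. *)
Lemma common_zero (L1 L2 : {mpoly K[3]}) : L1 \is 1.-homog -> L2 \is 1.-homog ->
  exists p i, [/\ p i = 1, L1.@[p] = 0 & L2.@[p] = 0].
Proof.
move=> L1h L2h; pose A : 'M[K]_(3, 2) := \matrix_(j, a) (if a == 0 then L1 else L2)@_U_(j).
have : kermx A != 0.
  by rewrite kermx_eq0 /row_free neq_ltn (leq_ltn_trans (rank_leq_col A)).
move=> /rowV0Pn[u /sub_kermxP uA uN0].
have [i ui] : exists i, u 0 i != 0.
  apply: contrapT => H; case/eqP: uN0; apply/rowP => i; rewrite mxE.
  by apply/eqP/negPn/negP => ui; apply: H; exists i.
have LE L : L \is 1.-homog -> L.@[fun j => u 0 j / u 0 i] = (\sum_j u 0 j * L@_U_(j)) / u 0 i.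
  move=> Lh; rewrite {1}(linear_form_eq Lh) rmorph_sum mulr_suml; apply: eq_bigr => j _.
  by rewrite /= mevalZ mevalXU; ring.
exists (fun j => u 0 j / u 0 i), i; split; first by rewrite divff.
  rewrite LE //; have := congr1 (fun B : 'rV_2 => B 0 0) uA; rewrite !mxE => e0.
  by rewrite (eq_bigr (fun j => u 0 j * A j 0)) ?e0 ?mul0r // => j _; rewrite mxE.
rewrite LE //; have := congr1 (fun B : 'rV_2 => B 0 1) uA; rewrite !mxE => e0.
by rewrite (eq_bigr (fun j => u 0 j * A j 1)) ?e0 ?mul0r // => j _; rewrite mxE.
Qed.

Lemma singular_normal_form (L1 L2 F1 F2 : {mpoly K[3]}) :
  L1 \is 1.-homog -> L2 \is 1.-homog -> F1 \is k.-homog -> F2 \is k.-homog ->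
  exists i p H, [/\ H \is (k + 2).-homog, forall m : 'X_{1..3}, (k < m i)%N -> H@_m = 0 &
    L1 ^+ 2 * F1 + L2 ^+ 2 * F2 = H \mPo shear i p].
Proof.
move=> L1h L2h F1h F2h; have [p [i [pi z1 z2]]] := common_zero L1h L2h.
(* [H] is the sum with its singular point moved to the coordinate point; the inverse shear brings it
   back. *)
exists i, (fun j => - p j), ((L1 ^+ 2 * F1 + L2 ^+ 2 * F2) \mPo shear i p).
split; last by rewrite shearK.
  apply: comp_mpoly_homog; first exact: shear_homog.
  by rewrite addnC rpredD // dhomogM //; [apply: (dhomogMn 2 L1h) | apply: (dhomogMn 2 L2h)].
by move=> m km; rewrite comp_mpolyD mcoeffD !square_times_support ?addr0.
Qed.

End SingularForms.

(** * Parametrization by [D.-1] variables and the defect *)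

Section Defect.
Local Open Scope ring_scope.
Local Open Scope classical_set_scope.
Variable K : closedFieldType.
Hypothesis charK : [pchar K] =i pred0.
Variable k : nat.
Implicit Types (i j : 'I_3) (m : 'X_{1..3}) (p : 'I_3 -> K).
Local Notation V := (form K 2 (k + 2)).
Local Notation D := (\dim {:V}).

Definition monomials : seq 'X_{1..3} :=
  [seq s2m t | t : (k + 2).-tuple 'I_3 <- enum (basis 3 (k + 2))].

Lemma mem_monomials m : (m \in monomials) = (mdeg m == (k + 2)%N).
Proof. by rewrite -basis_cover. Qed.

Lemma size_monomials : size monomials = D.
Proof. by rewrite size_basis dimvf. Qed.

Lemma sum_monomials (G : {mpoly K[3]}) : G \is (k + 2).-homog ->
  G = \sum_(m <- monomials) G@_m *: 'X_[m].
Proof.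
move=> Gh; apply/mpolyP => m; rewrite raddf_sum /=.
have [dm|dm] := boolP (m \in monomials).
  rewrite (bigD1_seq m) ?uniq_basis //= mcoeffZ mcoeffX eqxx mulr1 big1 ?addr0 // => m' ne.
  by rewrite mcoeffZ mcoeffX (negbTE ne) mulr0.
rewrite (dhomog_nemf_coeff Gh) -?mem_monomials // big1_seq // => m' /= m'm.
rewrite mcoeffZ mcoeffX; case: eqP => [e|]; last by rewrite mulr0.
by rewrite -e m'm in dm.
Qed.

(** A form singular at the [i]-th coordinate point has coefficient 0 at ['X_i ^+ (k + 2)], so that
    monomial gets no parameter. *)
Definition params i := rem (U_(i) *+ (k + 2))%MM monomials.

Lemma size_params i : size (params i) = D.-1.
Proof. by rewrite size_rem ?size_monomials // mem_monomials mdegMn mdeg1 mul1n. Qed.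

Definition param i m : {mpoly K[D.-1]} :=
  if insub (index m (params i)) is Some o then 'X_o else 0.

Lemma meval_param i m (c : 'X_{1..3} -> K) : m \in monomials -> m != (U_(i) *+ (k + 2))%MM ->
  (param i m).@[fun o => c (nth 0%MM (params i) o)] = c m.
Proof.
move=> mm mi; have mp : m \in params i by rewrite mem_rem_uniq ?uniq_basis // inE mi.
have lt : (index m (params i) < D.-1)%N by rewrite -(size_params i) index_mem.
by rewrite /param insubT mevalXU /= nth_index.
Qed.

(* The coordinates of the singular point are stored in the parameters attached
   to the monomials [X_j * X_i ^+ k.+1], whose coefficients vanish. *)
Definition generic_singular i : {mpoly {mpoly K[D.-1]}[3]} :=
  \sum_(m <- monomials | (m i <= k)%N) param i m *:
    \prod_j tnth (shear i (fun j => param i (U_(j) + U_(i) *+ k.+1)%MM)) j ^+ m j.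

Lemma generic_singularP i p (H : {mpoly K[3]}) : H \is (k + 2).-homog ->
  (forall m, (k < m i)%N -> H@_m = 0) ->
  exists t, H \mPo shear i p = map_mpoly (meval t) (generic_singular i).
Proof.
move=> Hh Hi.
(* [c] gives the parameter values: coefficients of [H] where they may be nonzero, and at
   [X_j * X_i ^+ k.+1] with [j != i] the sum collapses to [p j]. *)
pose c m := if (m i <= k)%N then H@_m else \sum_(j | j != i) p j *+ m j.
pose t o := c (nth 0%MM (params i) o); exists t.
have Ui j : j != i -> (U_(j) + U_(i) *+ k.+1)%MM i = k.+1.
  by move=> ji; rewrite mnmDE mulmnE !mnm1E eqxx (negbTE ji) mul1n.
have pE j : j != i -> (param i (U_(j) + U_(i) *+ k.+1)%MM).@[t] = p j.
  move=> ji; rewrite meval_param.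
  - rewrite /c Ui // ltnn (bigD1 j) //= big1 => [|l /andP[li lj]].
      by rewrite mnmDE mulmnE !mnm1E eqxx eq_sym (negbTE ji) mul0n addn0 mulr1n addr0.
    by rewrite mnmDE mulmnE !mnm1E eq_sym (negbTE lj) eq_sym (negbTE li) mul0n addn0 mulr0n.
  - by rewrite mem_monomials mdegD mdegMn !mdeg1 mul1n add1n addn2.
  - apply/eqP => /mnmP/(_ i); rewrite Ui // mulmnE mnm1E eqxx mul1n addn2 => /eqP.
    by rewrite eqn_leq ltnn andbF.
rewrite [in LHS](sum_monomials Hh) !raddf_sum /= [RHS]big_mkcond /= big_seq_cond [RHS]big_seq_cond.
apply: eq_bigr => m /andP[mm _]; rewrite comp_mpolyZ comp_mpolyX.
case: leqP => [mk|km]; last by rewrite Hi ?scale0r.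
rewrite map_mpolyZ rmorph_prod /= meval_param //; last first.
  apply: contraTneq mk => ->; rewrite mulmnE mnm1E eqxx mul1n -ltnNge addn2 //.
rewrite /c mk; congr (_ *: _); apply: eq_bigr => j _; rewrite rmorphXn /=; congr (_ ^+ _).
rewrite !tnth_mktuple rmorphD /= map_mpolyZ !map_mpolyX; congr (_ + _ *: _).
by case: eqVneq => [_|ji]; apply: esym; [exact: meval0 | exact: pE].
Qed.

Definition form_monomial m : V := indhomog (k + 2) 'X_[m].

Definition generic_coords i : D.-tuple {mpoly K[D.-1]} :=
  [tuple \sum_(m <- monomials) hcoord (form_monomial m) l *: (generic_singular i)@_m | l < D].

Lemma generic_coordsP i t (G : V) :
  (G : {mpoly K[3]}) = map_mpoly (meval t) (generic_singular i) ->
  forall l, hcoord G l = (tnth (generic_coords i) l).@[t].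
Proof.
move=> GE l; have -> : G = \sum_(m <- monomials) (G : {mpoly K[3]})@_m *: form_monomial m.
  apply/val_inj; rewrite raddf_sum /= {1}(sum_monomials (dhomog_is_dhomog G)).
  apply: eq_big_seq => m; rewrite mem_monomials => dm.
  by rewrite /form_monomial /indhomog insubdK // -topredE /= dhomogX.
rewrite tnth_mktuple rmorph_sum /hcoord linear_sum; apply: eq_bigr => m _.
by rewrite linearZ /= mevalZ GE mcoeff_map_mpoly mulrC.
Qed.

Lemma secant_points2 x (G : V) : secant_points 2 x -> G \in val x ->
  exists i t, forall l, hcoord G l = (tnth (generic_coords i) l).@[t].
Proof.
move=> [u [uO xu]] xG; have {xu xG} := subvP xu G xG.
rewrite !big_ord_recl big_ord0 addv0 => /memv_addP[G1 uG1 [G2 uG2 ->]].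
have split_point (a : 'I_2) : exists L F G',
    [/\ L \is [in K[3], 1.-homog], F \is [in K[3], k.-homog],
    val (u a) = <[G' : V]>%VS & (G' : {mpoly K[3]}) = L ^+ 2 * F].
  have [L [F [G' [_ _ G'E uE]]]] := uO a; rewrite addKn in G'E.
  by exists L, F, G'; split=> //; exact: dhomog_is_dhomog.
have [L1 [F1 [G1' [L1h F1h u1 G1E]]]] := split_point ord0.
have [L2 [F2 [G2' [L2h F2h u2 G2E]]]] := split_point (lift ord0 ord0).
move: uG1 uG2; rewrite u1 u2 => /vlineP[c1 ->] /vlineP[c2 ->].
(* The scalars [c1] and [c2] are absorbed into the cofactors. *)
have [i [p [H [Hh Hi E]]]] :=
  singular_normal_form charK L1h L2h (rpredZ c1 F1h) (rpredZ c2 F2h).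
have [t tE] := generic_singularP p Hh Hi.
by exists i, t; apply: generic_coordsP; rewrite -tE -E /= G1E G2E !scalerAr.
Qed.

(** A secant point may come from any of the three charts [i], so one relation is taken for each.
    Their product is nonzero and vanishes on all secant points, hence on the closure, against
    independence on [C]. *)
Lemma secant2_chain (m : nat) :
  irreducible_chain (@secant_osculating K 2 k 2 (k + 2)) m -> (m < D.-1)%N.
Proof.
move=> ch; rewrite ltnNge; apply/negP => leDm.
have [C CZ [g gC]] := chain_alg_indep charK ch.
have /choice[P PE] : forall i, exists P : {mpoly K[m.+1]},
    P != 0 /\ P \mPo [tuple tnth g l \mPo generic_coords i | l < m.+1] = 0.
  move=> i; have [|P] := alg_dep [tuple tnth g l \mPo generic_coords i | l < m.+1].
    by rewrite ltnS.
  by exists P.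
have : \prod_i P i != 0 by apply/prodf_neq0 => i _; have [] := PE i.
case/eqP; apply: gC => x /CZ; apply: vanishes_on_zariski_closure => // y yA v yv _.
have [i [t tE]] := secant_points2 yA yv.
rewrite comp_mpoly_meval rmorph_prod (bigD1 i) //=.
suff -> : (P i).@[fun l => (tnth g l).@[hcoord v]] = 0 by rewrite mul0r.
have := congr1 (meval t) (PE i).2; rewrite meval0 comp_mpoly_meval => e0.
rewrite -[RHS]e0; apply: meval_eq => l; rewrite tnth_mktuple comp_mpoly_meval.
by apply: meval_eq => l'; rewrite tE.
Qed.

Lemma secant_osculating_neq0 s : (0 < s)%N -> @secant_osculating K s k 2 (k + 2) !=set0.
Proof.
move=> s0; have X0 : 'X_0 != 0 :> {mpoly K[3]} by rewrite -msize_poly_eq0 msizeX.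
have Xkh : 'X_0 ^+ k \is [in K[3], k.-homog] by rewrite mpolyXn dhomogX /= mdegMn mdeg1 mul1n.
have [x xO _] := osculating_point X0 (X_homog K 0) Xkh.
exists x; apply: sub_zariski_closure; exists (fun=> x); split=> //.
by rewrite (bigD1 (Ordinal s0)) //= addvSl.
Qed.

(** Comparing the two terms of [expdim] reduces to [k <= k * k]; they are equal for [k = 1]. *)
Lemma expdim2 : (1 <= k)%N -> expdim 2 k 2 (k + 2) = D.-1.
Proof.
have DE : (D = 'C(k.+4, 2))%N.
  have -> : D = 'C(k + 2 + 2, k + 2)%N by rewrite dimvf.
  by rewrite -bin_sub ?leq_addr // addKn !addn2.
move=> k1; rewrite DE /expdim subn1 !addn2 add2n; apply/minn_idPl.
have bin2E n : ('C(n.+2, 2) * 2 = n.+2 * n.+1)%N.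
  by apply: etrans (bin_ffact n.+2 2) _; rewrite ffactnS ffactn1.
move: (bin2E k) (bin2E k.+2).
have kk : (k <= k * k)%N by rewrite leq_pmulr.
move: 'C(_, _) 'C(_, _) => a b. nia.
Qed.

Lemma defective2 : (1 <= k)%N -> defective K 2 k 2 (k + 2).
Proof.
move=> k1; pose Z := @secant_osculating K 2 k 2 (k + 2).
have [x Zx] : Z !=set0 by exact: secant_osculating_neq0.
(* [defective] asks for an actual dimension: chains exist and their lengths are bounded, so a
   longest one exists. *)
have ex_chain : exists m : nat, `[< irreducible_chain Z m >].
  by exists 0%N; apply/asboolP; apply: irreducible_chain_point Zx.
have chain_le (m : nat) : `[< irreducible_chain Z m >] -> (m <= D.-1)%N.
  by move/asboolP/secant2_chain/ltnW.
case: (ex_maxnP ex_chain chain_le) => m /asboolP chm max_m.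
exists m; last by rewrite expdim2 //; exact: secant2_chain.
by split=> // m' chm'; apply: max_m; apply/asboolP.
Qed.

End Defect.

Theorem corollary3p3 (K : closedFieldType) (charK : [pchar K]%R =i pred0)
    (k : nat) (k_ge1 : 1 <= k) :
  (forall s : nat, 3 <= s -> ~ defective K s k 2 (k + 2)) /\
  defective K 2 k 2 (k + 2).
Proof.
split=> [s s_ge3|]; first exact: not_defective.
exact: defective2.
Qed.
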